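(* Let $\mathfrak{A}$ be a $C^*$-algebra with unit $1$, let $\mathfrak{X}$ be a Hilbert $\mathfrak{A}$-module, and let $e_1,\dots,e_m\in\mathfrak{X}$ satisfy $\langle e_i,e_j\rangle=0$ for $1\le i\ne j\le m$ and $\|e_i\|=1$ for $1\le i\le m$. Suppose that $r_k,\rho_k\in\mathbb{R}$ $(1\le k\le m)$ and that the vectors $x_1,\dots,x_n\in\mathfrak{X}$ satisfy, for all $1\le j\le n$ and $1\le k\le m$, $$0\le r_k^2\|x_j\|\le \mathrm{Re}\,\langle r_ke_k,x_j\rangle,\qquad 0\le \rho_k^2\|x_j\|\le \mathrm{Im}\,\langle \rho_ke_k,x_j\rangle .$$ Then $$\left[\sum_{k=1}^m(r_k^2+\rho_k^2)\right]^{1/2}\sum_{j=1}^n\|x_j\|\le\left\|\sum_{j=1}^nx_j\right\|,$$ and equality holds in this inequality if and only if $$\sum_{j=1}^n x_j=\sum_{j=1}^n\|x_j\|\,\sum_{k=1}^m(r_k+i\rho_k)e_k .$$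
   Context: A Hilbert $\mathfrak{A}$-module is a complex linear space $\mathfrak{X}$ that is a right $\mathfrak{A}$-module with an $\mathfrak{A}$-valued inner product $\langle\cdot,\cdot\rangle$ such that $\langle x,x\rangle\ge 0$ with equality iff $x=0$; $\langle x,\lambda y+z\rangle=\lambda\langle x,y\rangle+\langle x,z\rangle$; $\langle x,ya\rangle=\langle x,y\rangle a$; $\langle x,y\rangle^*=\langle y,x\rangle$ (so it is conjugate linear in the first variable and linear in the second), and that is complete in the norm $\|x\|=\|\langle x,x\rangle\|^{1/2}$. For $a\in\mathfrak{A}$, $\mathrm{Re}\,a=\frac{a+a^*}{2}$ and $\mathrm{Im}\,a=\frac{a-a^*}{2i}$. A scalar $\lambda\in\mathbb{C}$ is identified with $\lambda 1\in\mathfrak{A}$, and inequalities between self-adjoint elements of $\mathfrak{A}$ refer to the usual order of the $C^*$-algebra ($a\le b$ iff $b-a$ is positive). *)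

(* Defs.v *)
From HB Require Import structures.
From mathcomp Require Import all_boot all_order all_algebra.
From mathcomp Require Import complex.
From mathcomp Require Import all_classical all_reals all_analysis.

Set Implicit Arguments.
Unset Strict Implicit.
Unset Printing Implicit Defensive.
Import Order.TTheory GRing.Theory Num.Theory.
Import numFieldNormedType.Exports.
Local Open Scope ring_scope.
Local Open Scope complex_scope.

(* The norm of a normed module over R[i] takes its values in R[i]; these are  *)
(* nonnegative for the partial order of R[i] (z <= w iff w - z is a           *)
(* nonnegative real), so inequalities between norms are the usual ones.       *)

(* HB cannot join CompleteNormedModule with Algebra (NumDomain already         *)
(* inherits from normed Z-modules and rings), so the product is part of the   *)
(* mixin and the algType structure is attached to the carrier afterwards.     *)
HB.mixin Record isCStarAlgebra (R : realType) A
    of CompleteNormedModule R[i] A := {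
  cone : A ;
  cmul : A -> A -> A ;
  cstar : A -> A ;
  cmulA : associative cmul ;
  cmul1l : left_id cone cmul ;
  cmul1r : right_id cone cmul ;
  cmulDl : left_distributive cmul +%R ;
  cmulDr : right_distributive cmul +%R ;
  cone_neq0 : cone != 0 ;
  cmulZl : forall (l : R[i]) (a b : A), l *: cmul a b = cmul (l *: a) b ;
  cmulZr : forall (l : R[i]) (a b : A), l *: cmul a b = cmul a (l *: b) ;
  cnormM_le : forall a b : A, `|cmul a b| <= `|a| * `|b| ;
  cstarD : forall a b : A, cstar (a + b) = cstar a + cstar b ;
  cstarZ : forall (l : R[i]) (a : A), cstar (l *: a) = Num.conj l *: cstar a ;
  cstarM : forall a b : A, cstar (cmul a b) = cmul (cstar b) (cstar a) ;
  cstarK : forall a : A, cstar (cstar a) = a ;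
  cnorm_star : forall a : A, `|cmul (cstar a) a| = `|a| ^+ 2
}.

#[short(type="cstarAlgType")]
HB.structure Definition CStarAlgebra (R : realType) :=
  { A of isCStarAlgebra R A & CompleteNormedModule R[i] A }.

HB.instance Definition _ (R : realType) (A : cstarAlgType R) :=
  GRing.Zmodule_isNzRing.Build (CStarAlgebra.sort A)
    (@cmulA R A) (@cmul1l R A) (@cmul1r R A) (@cmulDl R A) (@cmulDr R A)
    (@cone_neq0 R A).
HB.instance Definition _ (R : realType) (A : cstarAlgType R) :=
  GRing.Lmodule_isLalgebra.Build R[i] (CStarAlgebra.sort A) (@cmulZl R A).
HB.instance Definition _ (R : realType) (A : cstarAlgType R) :=
  GRing.Lalgebra_isAlgebra.Build R[i] (CStarAlgebra.sort A) (@cmulZr R A).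

Section CStarOrder.
Context {R : realType} {A : cstarAlgType R}.
Implicit Types a b : A.

Definition cinvertible a : Prop := exists b, a * b = 1 /\ b * a = 1.

Definition cspectrum a : set R[i] := [set l | ~ cinvertible (a - l%:A)].

(* For l : R[i], 0 <= l says that l is real and nonnegative. *)
Definition cpositive a : Prop :=
  cstar a = a /\ (forall l : R[i], cspectrum a l -> 0 <= l).

Definition cle a b : Prop := cpositive (b - a).

Definition creal a : A := 2^-1 *: (a + cstar a).
Definition cimag a : A := (2 * 'i)^-1 *: (a - cstar a).

End CStarOrder.

Notation "a <=A b" := (cle a b) (at level 70, no associativity) : ring_scope.
Notation "a <=A b <=A c" := (cle a b /\ cle b c)
  (at level 70, b at next level, no associativity) : ring_scope.

(* Associativity with scalars, (l *: x) . a = l *: (x . a) = x . (l *: a),    *)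
(* is not listed: it follows from hinner_linr, hinner_act and hinner_eq0.     *)
HB.mixin Record isHilbertModule (R : realType) (A : cstarAlgType R) X
    of CompleteNormedModule R[i] X := {
  ract : X -> A -> X ;
  ractDl : forall (x y : X) (a : A), ract (x + y) a = ract x a + ract y a ;
  ractDr : forall (x : X) (a b : A), ract x (a + b) = ract x a + ract x b ;
  ractM : forall (x : X) (a b : A), ract x (a * b) = ract (ract x a) b ;
  ract1 : forall x : X, ract x 1 = x ;
  hinner : X -> X -> A ;
  hinner_ge0 : forall x : X, 0 <=A hinner x x ;
  hinner_eq0 : forall x : X, hinner x x = 0 <-> x = 0 ;
  hinner_linr : forall (l : R[i]) (x y z : X),
    hinner x (l *: y + z) = l *: hinner x y + hinner x z ;
  hinner_act : forall (x y : X) (a : A), hinner x (ract y a) = hinner x y * a ;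
  hinnerC : forall x y : X, cstar (hinner x y) = hinner y x ;
  hnormE : forall x : X, `|x| = sqrtC `|hinner x x|
}.

#[short(type="hilbertModType")]
HB.structure Definition HilbertModule (R : realType) (A : cstarAlgType R) :=
  { X of isHilbertModule R A X & CompleteNormedModule R[i] X }.

(* Main.v *)
(* A positive a satisfies ||t - a|| <= t for some real t; this bound passes to
   sums and stands in for the order of the C*-algebra. Put S = sum_j x_j,
   T = sum_j ||x_j||, C = sum_k (r_k^2 + rho_k^2) and
   y = sum_k (r_k + i rho_k) e_k. The hypotheses give
   <y, S> + <S, y> >= 2 C T, and <y, y> <= C because ||e_k|| = 1, so
     0 <= <S - T y, S - T y> <= <S, S> - C T^2.
   This gives the inequality; if it is an equality, then <S, S> <= C T^2 forces
   S = T y.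
   The passage from spectra to norms needs that a self-adjoint a has spectral
   radius ||a||; it is obtained without complex analysis, from repeated squaring
   and the bound ||(1 - s^2) / (1 + s^2)|| <= 1 for self-adjoint s. *)

From HB Require Import structures.
Require Import Defs.
From mathcomp Require Import all_boot all_order all_algebra.
From mathcomp Require Import complex.
From mathcomp Require Import all_classical all_reals all_analysis.
From mathcomp Require Import ring lra.

Set Implicit Arguments.
Unset Strict Implicit.
Unset Printing Implicit Defensive.
Import Order.TTheory GRing.Theory Num.Theory.
Import numFieldNormedType.Exports.
Local Open Scope ring_scope.
Local Open Scope complex_scope.

(** * Norms as real numbers, and completeness *)

(** A norm in [R[i]] is a nonnegative real, so its real part loses nothing and makes estimates
    available to [lra] and [nra]. *)
Definition rnorm (R : realType) (V : normedModType R[i]) (a : V) : R :=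
  complex.Re `|a|.

Section RealNorm.
Context {R : realType} {V : normedModType R[i]}.
Implicit Types a b : V.

Lemma rnormE a : `|a| = (rnorm a)%:C.
Proof. by rewrite /rnorm RRe_real // ger0_real. Qed.

Lemma rnorm_ge0 a : 0 <= rnorm a.
Proof. by rewrite -ler0c -rnormE. Qed.

Lemma rnormD a b : rnorm (a + b) <= rnorm a + rnorm b.
Proof. by rewrite -lecR rmorphD /= -!rnormE ler_normD. Qed.

Lemma rnormN a : rnorm (- a) = rnorm a.
Proof. by rewrite /rnorm normrN. Qed.

Lemma rnormB a b : rnorm (a - b) <= rnorm a + rnorm b.
Proof. by rewrite -(rnormN b) rnormD. Qed.

Lemma rnorm0 : rnorm (0 : V) = 0.
Proof. by rewrite /rnorm normr0. Qed.

Lemma rnorm0_eq0 a : rnorm a = 0 -> a = 0.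
Proof. by move=> a0; apply/normr0_eq0; rewrite rnormE a0. Qed.

Lemma rnormZ (t : R) a : rnorm (t%:C *: a) = `|t| * rnorm a.
Proof.
apply: (@complexI R); rewrite -rnormE normrZ rnormE rmorphM /=; congr (_ * _).
by rewrite normc_def /= expr0n addr0 sqrtr_sqr.
Qed.

Lemma rnormMn a n :
  rnorm (a *+ n) = rnorm a *+ n.
Proof. by rewrite /rnorm normrMn raddfMn. Qed.

Lemma rnorm_sum (I : finType) (F : I -> V) :
  rnorm (\sum_i F i) <= \sum_i rnorm (F i).
Proof.
elim/big_ind2: _ => [|a s b t as_ bt|//]; first by rewrite rnorm0.
by apply: le_trans (rnormD _ _) _; rewrite lerD.
Qed.

End RealNorm.

(** The geometric bound makes [u] Cauchy. The limit is given with epsilons, ready for the Neumann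
    series. *)
Lemma rnorm_complete (R : realType) (V : completeNormedModType R[i])
    (u : nat -> V) (q M : R) : 0 <= q < 1 ->
  (forall n m, rnorm (u (n + m)%N - u n) <= M * q ^+ n) ->
  exists l, forall eps, 0 < eps ->
    exists n0, forall n, (n0 <= n)%N -> rnorm (l - u n) < eps.
Proof.
move=> /andP[q0 q1] uM.
have small (eps : R) : 0 < eps -> exists n, M * q ^+ n < eps.
  move=> e0.
  have := cvg_geometric M.
  move=> /(_ q); rewrite ger0_norm // => /(_ q1).
  move=> /cvgrPdist_lt /(_ eps e0) [n _ /(_ n (leqnn _))].
  rewrite /geometric /= sub0r normrN => h; exists n.
  exact: le_lt_trans (ler_norm _) h.
have cu : cauchy (u @ \oo)%classic.
  apply/cauchy_exP => e e0.
  have [er e0'] : e = (complex.Re e)%:C /\ 0 < complex.Re e.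
    by move: (e0); rewrite ltcE => /andP[_ ?]; rewrite RRe_real ?gtr0_real.
  have [n hn] := small _ e0'.
  exists (u n); exists n => //= k /= nk.
  rewrite -ball_normE /= er rnormE ltcR -(subnKC nk).
  by rewrite -rnormN opprB; exact: le_lt_trans (uM _ _) hn.
have /cauchy_cvgP/cvg_ex[l /cvgrPdist_lt ul] := cu.
exists l => e e0.
have [] := ul e%:C; first by rewrite ltcR.
move=> n0 _ h; exists n0 => n nn; have := h n nn => /=.
by rewrite rnormE ltcR.
Qed.

(** * Star and norm identities in a C*-algebra *)

Section CStar.
Context {R : realType} {A : cstarAlgType R}.
Implicit Types a b d s : A.

Lemma rnormM a b : rnorm (a * b) <= rnorm a * rnorm b.
Proof. by rewrite -lecR rmorphM /= -!rnormE; exact: cnormM_le. Qed.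

Lemma rnorm_star_mul a : rnorm (cstar a * a) = rnorm a ^+ 2.
Proof. by apply: (@complexI R); rewrite rmorphXn /= -!rnormE cnorm_star. Qed.

(** This restates [cstarM] with the ring product in place of [cmul], so that it can be used for
    rewriting. *)
Lemma cstarM1 a b : cstar (a * b) = cstar b * cstar a.
Proof. exact: cstarM. Qed.

Lemma cstar1 : cstar (1 : A) = 1.
Proof. by rewrite -[LHS]mulr1 -[X in _ * X]cstarK -cstarM1 mulr1 cstarK. Qed.

Lemma cstar_is_additive : additive (@cstar R A).
Proof.
move=> a b; rewrite cstarD; congr (_ + _).
by rewrite -scaleN1r cstarZ rmorphN1 scaleN1r.
Qed.

HB.instance Definition _ := GRing.isAdditive.Build A A
  (@cstar R A) cstar_is_additive.

Lemma cstarZr (t : R) a : cstar (t%:C *: a) = t%:C *: cstar a.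
Proof. by rewrite cstarZ [Num.conj _]conjc_real. Qed.

Lemma cstarZi a : cstar ('i *: a) = - ('i *: cstar a).
Proof. by rewrite cstarZ -scaleNr; congr (_ *: _); rewrite conjCi. Qed.

Lemma rnorm1 : rnorm (1 : A) = 1.
Proof.
have h : rnorm (1 : A) != 0 by apply/eqP => /rnorm0_eq0 /eqP; rewrite oner_eq0.
apply: (mulIf h); rewrite mul1r -expr2 -rnorm_star_mul.
by rewrite cstar1 mulr1.
Qed.

Lemma rnormX a n : rnorm (a ^+ n) <= rnorm a ^+ n.
Proof.
elim: n => [|n ih]; first by rewrite !expr0 rnorm1.
by rewrite !exprS (le_trans (rnormM _ _))// ler_wpM2l ?rnorm_ge0.
Qed.

Lemma rnorm_star_le a : rnorm a <= rnorm (cstar a).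
Proof.
have [->|a0] := eqVneq (rnorm a) 0; first exact: rnorm_ge0.
rewrite -(ler_pM2r (_ : 0 < rnorm a)) ?lt0r ?a0 ?rnorm_ge0 //.
by rewrite -expr2 -rnorm_star_mul rnormM.
Qed.

Lemma rnorm_star a : rnorm (cstar a) = rnorm a.
Proof. by apply/le_anti; rewrite -{2}(cstarK a) !rnorm_star_le. Qed.

Lemma rnorm_sqr a : cstar a = a -> rnorm (a ^+ 2) = rnorm a ^+ 2.
Proof. by move=> sa; rewrite -rnorm_star_mul sa expr2. Qed.

(** * Neumann series and inverses *)

Lemma cinvertible_1B a : rnorm a < 1 -> cinvertible (1 - a).
Proof.
move=> a1; pose u n := \sum_(i < n) a ^+ i.
have a0 := rnorm_ge0 a.
have geo n m : rnorm (u (n + m)%N - u n) <= (1 - rnorm a)^-1 * rnorm a ^+ n.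
  have -> : u (n + m)%N - u n = a ^+ n * u m.
    rewrite /u big_split_ord /= addrAC subrr add0r mulr_sumr.
    by apply: eq_bigr => i _; rewrite exprD.
  apply: le_trans (rnormM _ _) _; rewrite mulrC ler_pM ?rnorm_ge0 ?rnormX //.
  apply: le_trans (rnorm_sum _) _.
  apply: (@le_trans _ _ (\sum_(i < m) rnorm a ^+ i)).
    by apply: ler_sum => i _; exact: rnormX.
  rewrite -[X in _ <= X]mul1r ler_pdivlMr ?subr_gt0 //.
  rewrite -opprB mulrN mulrC -subrX1 opprB gerBl exprn_ge0 //.
have [] := rnorm_complete _ geo; first by rewrite a0.
move=> l ul; exists l.
have uE n : (1 - a) * u n = 1 - a ^+ n.
  by rewrite -opprB mulNr -subrX1 opprB.
have uC n : (1 - a) * u n = u n * (1 - a).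
  by apply/commr_sym/commrB; [exact: commr1|
     apply/commr_sym/commr_sum => i _; exact: commrX].
(* The added 1 makes the factor positive, so that it can be divided by below. *)
have M0 : 0 < rnorm (1 - a) + 1 by rewrite ltr_wpDl ?rnorm_ge0.
(* Both defects [(1 - a) * l - 1] and [l * (1 - a) - 1] satisfy this bound for every [n], because
   [(1 - a) * u n = 1 - a ^+ n]. *)
have zero_small (z : A) : (forall n, rnorm z <=
    (rnorm (1 - a) + 1) * rnorm (l - u n) + rnorm a ^+ n) -> z = 0.
  move=> h; apply/rnorm0_eq0/le_anti; rewrite rnorm_ge0 andbT.
  apply/ler_addgt0Pl => e e0.
  have e20 : 0 < e / 2 / (rnorm (1 - a) + 1) by rewrite !divr_gt0.
  have [n0 h0] := ul _ e20.
  have : (rnorm a ^+ n @[n --> \oo] --> (0 : R))%classic.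
    by apply: cvg_expr; rewrite ger0_norm.
  move=> /cvgrPdist_lt /(_ (e / 2)) []; first by rewrite divr_gt0.
  move=> n1 _ h1; pose n := maxn n0 n1.
  have := h0 n (leq_maxl _ _); rewrite ltr_pdivlMr // => {}h0.
  have := h1 n (leq_maxr _ _); rewrite /= sub0r normrN ger0_norm ?exprn_ge0 //
    => {}h1.
  by rewrite addr0; have := h n; lra.
split; apply/eqP; rewrite -subr_eq0; apply/eqP/zero_small => n.
  have -> : (1 - a) * l - 1 = (1 - a) * (l - u n) - a ^+ n.
    by rewrite mulrBr uE opprB [a ^+ n - 1]addrC addrA addrK.
  apply: le_trans (rnormB _ _) _; rewrite lerD ?rnormX //.
  by rewrite (le_trans (rnormM _ _)) // ler_wpM2r ?rnorm_ge0 ?lerDl.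
have -> : l * (1 - a) - 1 = (l - u n) * (1 - a) - a ^+ n.
  by rewrite mulrBl -uC uE opprB [a ^+ n - 1]addrC addrA addrK.
apply: le_trans (rnormB _ _) _; rewrite lerD ?rnormX //.
by rewrite (le_trans (rnormM _ _)) // mulrC ler_wpM2r ?rnorm_ge0 ?lerDl.
Qed.

(** Naming the inverse allows norm estimates between inverses. *)
Definition cinverse a b : Prop := a * b = 1 /\ b * a = 1.

Lemma cinverseM a a' b b' :
  cinverse a a' -> cinverse b b' -> cinverse (a * b) (b' * a').
Proof.
move=> [aa' a'a] [bb' b'b]; split.
  by rewrite mulrA -(mulrA a) bb' mulr1.
by rewrite mulrA -(mulrA b') a'a mulr1.
Qed.

Lemma cinverseZ (c : R[i]) a a' : c != 0 ->
  cinverse a a' -> cinverse (c *: a) (c^-1 *: a').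
Proof.
move=> c0 [aa' a'a]; split; rewrite -scalerAl -scalerAr scalerA.
  by rewrite mulfV // aa' scale1r.
by rewrite mulVf // a'a scale1r.
Qed.

Lemma cinverse_star a b : cinverse a b -> cinverse (cstar a) (cstar b).
Proof. by move=> [ab ba]; split; rewrite -cstarM1 ?ab ?ba cstar1. Qed.

Lemma cinvertibleB (t : R) a : rnorm a < t -> cinvertible (t%:C%:A - a).
Proof.
move=> at_; have t0 : 0 < t := le_lt_trans (rnorm_ge0 a) at_.
have tC : t%:C != 0 by rewrite (inj_eq (@complexI R)) gt_eqF.
have [|b ab] := @cinvertible_1B (t^-1%:C *: a).
  by rewrite rnormZ ger0_norm ?invr_ge0 ?ltW // mulrC ltr_pdivrMr ?mul1r.
exists (t%:C^-1 *: b).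
have -> : t%:C%:A - a = t%:C *: (1 - t^-1%:C *: a).
  by rewrite scalerBr scalerA -rmorphM /= mulfV ?gt_eqF // scale1r.
exact: cinverseZ.
Qed.

Lemma cstarX s n : cstar (s ^+ n) = cstar s ^+ n.
Proof.
elim: n => [|n ih]; first by rewrite !expr0 cstar1.
by rewrite exprSr cstarM1 ih exprS.
Qed.

(** * Resolvents under repeated squaring, and the spectral radius *)

Lemma mul1Dx1Bx a : (1 + a) * (1 - a) = 1 - a ^+ 2.
Proof. by rewrite mulrBr mulr1 mulrDl mul1r opprD addrA addrK expr2. Qed.

Lemma mul1Bx1Dx a : (1 - a) * (1 + a) = 1 - a ^+ 2.
Proof. by rewrite mulrDr mulr1 mulrBl mul1r addrA addrNK expr2. Qed.

(* [2 (1 + s^2)^-1 - 1] is the real part of the Cayley transform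
   [u = (1 - is) (1 + is)^-1], which is unitary. *)
Lemma cayley s : cstar s = s -> rnorm s <= 1 ->
  exists2 e, cinverse (1 + s ^+ 2) e & rnorm (e *+ 2 - 1) <= 1.
Proof.
move=> ss s1; pose t := 'i *: s.
have ts : cstar t = - t by rewrite cstarZi ss.
have t2 : t ^+ 2 = - s ^+ 2.
  by rewrite !expr2 -scalerAl -scalerAr scalerA -expr2 sqr_i scaleN1r.
have tN : cstar (1 - t) = 1 + t by rewrite raddfB /= cstar1 ts opprK.
have tP : cstar (1 + t) = 1 - t by rewrite raddfD /= cstar1 ts.
have n1t : rnorm (1 - t) < 2.
  (* By the C*-identity, [rnorm (1 - t) ^+ 2] is the norm of [1 + s ^+ 2], at most 2 and so below 4.
     Then [1 + t = 2 - (1 - t)] is invertible by the Neumann series. *)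
  rewrite -(@ltr_pXn2r _ 2) ?nnegrE ?rnorm_ge0 // -rnorm_star_mul tN.
  rewrite mul1Dx1Bx t2 opprK.
  apply: le_lt_trans (rnormD _ _) _; rewrite rnorm1 rnorm_sqr // -natrX.
  have : rnorm s ^+ 2 <= 1 by rewrite exprn_ile1 ?rnorm_ge0.
  lra.
have [g gi] : cinvertible (1 + t).
  have := cinvertibleB n1t; congr cinvertible.
  by rewrite rmorph_nat scaler_nat mulr2n opprB addrA addrAC addrK.
have gsi := cinverse_star gi; rewrite tP in gsi.
have := cinverseM gsi gi; have := cinverseM gi gsi.
rewrite mul1Bx1Dx mul1Dx1Bx t2 opprK => e'i ei.
set e := cstar g * g in e'i.
have e2 : g + cstar g = e *+ 2.
  transitivity (cstar g * (1 - t) * g + cstar g * (1 + t) * g).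
    by rewrite gsi.2 mul1r -mulrA gi.1 mulr1.
  rewrite -mulrDl -mulrDr [1 - t + _]addrC addrA addrAC addrK.
  by rewrite mulrDr mulr1 mulrDl mulr2n.
exists e => //.
(* Since [(1 + t) * g = 1], [u] equals [(1 - t) * g], the Cayley transform. By [e2], [cstar u * u]
   expands to 1. *)
pose u := g *+ 2 - 1.
have us : cstar u = cstar g *+ 2 - 1 by rewrite raddfB raddfMn /= cstar1.
have u1 : rnorm u <= 1.
  rewrite -(@ler_pXn2r _ 2) ?nnegrE ?rnorm_ge0 // -rnorm_star_mul expr1n us.
  rewrite mulrBl mul1r mulrBr mulr1 mulrnAl mulrnAr -mulrnA.
  have -> : (e *+ (2 * 2) - cstar g *+ 2 - (g *+ 2 - 1)) = 1.
    by rewrite mulrnA -e2 mulrnDl addrK opprB addrC addrNK.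
  by rewrite rnorm1.
have : rnorm ((e *+ 2 - 1) *+ 2) <= 2.
  have -> : (e *+ 2 - 1) *+ 2 = u + cstar u.
    by rewrite us addrACA -mulrnDl e2 mulrnBl -opprD.
  by apply: le_trans (rnormD _ _) _; rewrite rnorm_star; lra.
by rewrite rnormMn; lra.
Qed.

(** With [e] the inverse of [1 + s ^+ 2], the new resolvent is the mean of [d] and [e]. Put
    [F = 2 d - 1] and [G = 2 e - 1]: these are mutually inverse, so [G - G' = G (F' - F) G']. As
    [cayley] bounds [G] and [G'] by 1, [e - e'] is no larger than [d - d'], and neither is the
    difference of the means. *)
Lemma square_resolvent_lipschitz s d s' d' :
  cstar s = s -> rnorm s <= 1 -> cinverse (1 - s ^+ 2) d ->
  cstar s' = s' -> rnorm s' <= 1 -> cinverse (1 - s' ^+ 2) d' ->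
  exists D D', [/\ cinverse (1 - (s ^+ 2) ^+ 2) D,
    cinverse (1 - (s' ^+ 2) ^+ 2) D' & rnorm (D - D') <= rnorm (d - d')].
Proof.
move=> ss s1 di ss' s1' di'.
have [e ei G1] := cayley ss s1; have [e' ei' G1'] := cayley ss' s1'.
pose h : R[i] := 2^-1%:C.
have half (q f p : A) : cinverse (1 - q) f -> cinverse (1 + q) p ->
    cinverse (1 - q ^+ 2) (h *: (f + p)).
  have h2 : h *: (2 : A) = 1.
    have -> : (2 : A) = (2%:C)%:A by rewrite rmorph_nat scaler_nat.
    by rewrite scalerA -rmorphM /= mulVf ?scale1r // pnatr_eq0.
  move=> [f1 f2] [p1 p2]; split.
    rewrite -scalerAr mulrDr -{1}mul1Dx1Bx -mul1Bx1Dx -!mulrA f1 p1 !mulr1.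
    by rewrite addrACA addrN addr0 h2.
  rewrite -scalerAl mulrDl -{1}mul1Bx1Dx -mul1Dx1Bx !mulrA f2 p2 !mul1r.
  by rewrite addrACA addrN addr0 h2.
exists (h *: (d + e)), (h *: (d' + e')); split; [exact: half|exact: half|].
have reflr (f q : A) : f * (1 + q) = 1 -> f * (1 - q) = f *+ 2 - 1.
  by move=> {2}<-; rewrite mulrBr mulrDr mulr1 opprD addrA mulr2n addrK.
have refll (f q : A) : (1 + q) * f = 1 -> (1 - q) * f = f *+ 2 - 1.
  by move=> {2}<-; rewrite mulrBl mulrDl mul1r opprD addrA mulr2n addrK.
have GF : (e *+ 2 - 1) * (d *+ 2 - 1) = 1.
  rewrite -(reflr _ _ ei.2) -(reflr _ (- s ^+ 2) di.2) opprK.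
  by rewrite mulrA -(mulrA e) di.1 mulr1 ei.2.
have FG : (d' *+ 2 - 1) * (e' *+ 2 - 1) = 1.
  rewrite -(refll _ _ ei'.1) -(refll _ (- s' ^+ 2) di'.1) opprK.
  by rewrite mulrA -(mulrA (1 + _)) di'.2 mulr1 ei'.1.
have ee' : (e - e') *+ 2 = (e *+ 2 - 1) * ((d' - d) *+ 2) * (e' *+ 2 - 1).
  have -> : (d' - d) *+ 2 = (d' *+ 2 - 1) - (d *+ 2 - 1).
    by rewrite opprB addrA addrNK mulrnBl.
  rewrite (mulrBr (e *+ 2 - 1)) mulrBl GF mul1r -mulrA FG mulr1.
  by rewrite opprB addrA addrNK mulrnBl.
have le_ee' : rnorm (e - e') <= rnorm (d - d').
  rewrite -(@ler_pMn2r _ 2) // -!rnormMn ee'.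
  rewrite -(rnormN ((d - d') *+ 2)) -mulNrn opprB.
  apply: le_trans (rnormM _ _) _; rewrite -[leRHS]mulr1 ler_pM ?rnorm_ge0 //.
  by apply: le_trans (rnormM _ _) _; rewrite ler_piMl ?rnorm_ge0.
rewrite -scalerBr rnormZ ger0_norm ?invr_ge0 // opprD addrACA.
by have := rnormD (d - d') (e - e'); lra.
Qed.

(** Each squaring has Lipschitz constant 1, so the bound does not degrade as [n] grows. *)
Lemma pow2_resolvent_lipschitz s d s' d' n :
  cstar s = s -> rnorm s <= 1 -> cinverse (1 - s ^+ 2) d ->
  cstar s' = s' -> rnorm s' <= 1 -> cinverse (1 - s' ^+ 2) d' ->
  exists D D', [/\ cinverse (1 - (s ^+ (2 ^ n)) ^+ 2) D,
    cinverse (1 - (s' ^+ (2 ^ n)) ^+ 2) D' & rnorm (D - D') <= rnorm (d - d')].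
Proof.
move=> ss s1 di ss' s1' di'.
elim: n => [|n [D [D' [Di Di' DD']]]]; first by exists d, d'.
have pow2 (r : A) : cstar r = r -> rnorm r <= 1 ->
    cstar (r ^+ (2 ^ n)) = r ^+ (2 ^ n) /\ rnorm (r ^+ (2 ^ n)) <= 1.
  move=> sr r1; rewrite cstarX sr; split=> //.
  by rewrite (le_trans (rnormX _ _)) // exprn_ile1 ?rnorm_ge0.
have [sn sn1] := pow2 _ ss s1; have [sn' sn1'] := pow2 _ ss' s1'.
have [E [E' [Ei Ei' EE']]] := square_resolvent_lipschitz sn sn1 Di sn' sn1' Di'.
exists E, E'; rewrite !expnSr !(exprM _ (2 ^ n)%N 2%N); split => //.
exact: le_trans EE' DD'.
Qed.

(* Comparing [s] with [v s] for [v < 1] close to [1]: the resolvents of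
   [(v s)^(2^n.+1)] tend to [1], those of [s^(2^n.+1)] stay close to them,
   which forces [s^(2^n.+1)] to be small, although it has norm [1]. *)
Lemma not_cinvertible_1Bsqr s :
  cstar s = s -> rnorm s = 1 -> ~ cinvertible (1 - s ^+ 2).
Proof.
move=> ss s1 [d di]; pose M := rnorm d.
have M0 : 0 <= M := rnorm_ge0 d.
have M1 : 1 <= (M + 1) ^+ 2 by nra.
(* This choice gives [dl * 2 * M <= 1 / 16], hence [M' <= 2 * M], and then [rnorm (d - d') <= 4 * dl
   * M ^+ 2 <= 1 / 8], before any [n] is chosen. *)
pose dl := (32 * (M + 1) ^+ 2)^-1.
have dlE : dl * (32 * (M + 1) ^+ 2) = 1.
  by rewrite mulVf //; apply: lt0r_neq0; lra.
have dl0 : 0 < dl by rewrite invr_gt0; lra.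
have dl1 : dl <= 32^-1 by nra.
pose v := 1 - dl.
have v01 : 0 <= v < 1 by rewrite /v; lra.
have /andP[v0 v1] := v01.
pose s' := v%:C *: s.
have ss' : cstar s' = s' by rewrite cstarZr ss.
have s'v : rnorm s' = v by rewrite rnormZ s1 mulr1 ger0_norm.
have s'1 : rnorm s' <= 1 by rewrite s'v ltW.
have [d' di'] : cinvertible (1 - s' ^+ 2).
  by apply: cinvertible_1B; rewrite rnorm_sqr // s'v expr_lt1.
have dd' : d - d' = (1 - v ^+ 2)%:C *: (d * s ^+ 2 * d').
  have -> : d - d' = d * ((1 - s' ^+ 2) - (1 - s ^+ 2)) * d'.
    by rewrite mulrBr mulrBl di.2 mul1r -mulrA di'.1 mulr1.
  rewrite opprB [1 - s' ^+ 2 + _]addrC addrA addrNK exprZn -rmorphXn /=.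
  rewrite -[X in X - _]scale1r -scalerBl -scalerAr -scalerAl.
  by rewrite rmorphB rmorph1.
pose M' := rnorm d'.
have M'0 : 0 <= M' := rnorm_ge0 d'.
have le_dd' : rnorm (d - d') <= dl * 2 * M * M'.
  rewrite dd' rnormZ ger0_norm ?subr_ge0 ?exprn_ile1 ?(ltW v1) //.
  rewrite -(mulrA (dl * 2)); apply: ler_pM; rewrite ?rnorm_ge0 //.
  - by rewrite subr_ge0 exprn_ile1 // ltW.
  - by rewrite /v; nra.
  - apply: le_trans (rnormM _ _) _; rewrite ler_wpM2r //.
    by apply: le_trans (rnormM _ _) _; rewrite rnorm_sqr // s1 expr1n mulr1.
have le_M' : M' <= M + dl * 2 * M * M'.
  have := rnormB d (d - d'); rewrite opprB addrC addrNK => h.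
  by apply: (le_trans h); rewrite lerD2l.
have dlM : dl * 2 * M <= 1 / 16 by nra.
have M'2 : M' <= 2 * M by nra.
have dd8 : rnorm (d - d') <= 1 / 8.
  apply: le_trans le_dd' _.
  have : dl * 2 * M * M' <= dl * 2 * M * (2 * M).
    by rewrite ler_wpM2l // !mulr_ge0 // ltW.
  nra.
have [n vn] : exists n, v ^+ (2 ^ n) <= 1 / 16.
  have : (v ^+ n @[n --> \oo] --> (0 : R))%classic.
    by apply: cvg_expr; rewrite ger0_norm.
  move=> /cvgrPdist_lt /(_ (1 / 16)) []; first by lra.
  move=> n _ h; exists n; have := h (2 ^ n)%N (ltnW (ltn_expl _ _)).
  move=> /(_ isT) /=.
  by rewrite sub0r normrN ger0_norm ?exprn_ge0 // => /ltW.
have s_le1 : rnorm s <= 1 by rewrite s1.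
have [D [D' [Di Di' DD']]] :=
  pow2_resolvent_lipschitz n ss s_le1 di ss' s'1 di'.
set q := s ^+ _ ^+ 2 in Di; set q' := s' ^+ _ ^+ 2 in Di'.
have q1 : rnorm q = 1.
  rewrite rnorm_sqr ?cstarX ?ss //; apply/eqP.
  rewrite sqrp_eq1 ?rnorm_ge0 //; apply/eqP.
  elim: {q q' Di Di' D D' DD' vn} n => [//|n ih].
  by rewrite expnSr exprM rnorm_sqr ?cstarX ?ss // ih expr1n.
have q'1 : rnorm q' <= 1 / 16.
  apply: le_trans (rnormX _ _) _.
  have h : rnorm (s' ^+ (2 ^ n)) <= 1 / 16.
    by apply: le_trans (rnormX _ _) _; rewrite s'v.
  by have := rnorm_ge0 (s' ^+ (2 ^ n)); nra.
have D'E : D' - 1 = q' * D'.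
  by rewrite -{1}Di'.1 mulrBl mul1r opprB addrC addrNK.
have le_D' : rnorm (D' - 1) <= 1 / 16 * rnorm D'.
  by rewrite D'E (le_trans (rnormM _ _)) // ler_wpM2r ?rnorm_ge0.
have D'2 : rnorm D' <= 2.
  have := rnormD (D' - 1) 1; rewrite addrNK rnorm1; lra.
(* One 1/8 comes from [D - D'], the other from [D' - 1]. *)
have le_D : rnorm (D - 1) <= 1 / 4.
  have := rnormD (D - D') (D' - 1); rewrite addrA addrNK; lra.
(* Taking norms here gives [1 <= 1 / 4 * 2], the contradiction. *)
have qE : q = (D - 1) * (1 - q).
  by rewrite mulrBl Di.2 mul1r opprB addrC addrNK.
have : rnorm (1 - q) <= 2 by have := rnormB (1 : A) q; rewrite rnorm1; lra.
have := rnormM (D - 1) (1 - q); rewrite -qE q1.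
have := rnorm_ge0 (D - 1); have := rnorm_ge0 (1 - q).
nra.
Qed.

(* The spectral radius of a self-adjoint element is its norm. *)
Lemma not_cinvertible_rnorm a : cstar a = a -> a != 0 ->
  ~ (cinvertible ((rnorm a)%:C%:A - a) /\ cinvertible ((rnorm a)%:C%:A + a)).
Proof.
move=> sa a0 [[b bi] [c ci]].
have na0 : rnorm a != 0 by apply: contra_neq a0 => /rnorm0_eq0.
have tC : (rnorm a)%:C != 0 by rewrite (inj_eq (@complexI R)).
pose s := (rnorm a)^-1%:C *: a.
have aE : a = (rnorm a)%:C *: s.
  by rewrite scalerA -rmorphM /= mulfV // scale1r.
apply: (@not_cinvertible_1Bsqr s); first by rewrite cstarZr sa.
  by rewrite rnormZ ger0_norm ?invr_ge0 ?rnorm_ge0 // mulVf.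
rewrite -mul1Bx1Dx.
have -> : 1 - s = (rnorm a)%:C^-1 *: ((rnorm a)%:C%:A - a).
  by rewrite {3}aE -scalerBr scalerA mulVf // scale1r.
have -> : 1 + s = (rnorm a)%:C^-1 *: ((rnorm a)%:C%:A + a).
  by rewrite {3}aE -scalerDr scalerA mulVf // scale1r.
eexists; apply: cinverseM; apply: cinverseZ; rewrite ?invr_eq0 //; eassumption.
Qed.

(** * Accretive elements in place of the order *)

(* A norm characterization of positivity for self-adjoint elements which,
   unlike the spectral one, is visibly stable under sums. *)
Definition accretive a : Prop := exists t : R, rnorm (t%:C%:A - a) <= t.

Lemma accretiveD a b : accretive a -> accretive b -> accretive (a + b).
Proof.
move=> [t ta] [u ub]; exists (t + u); rewrite rmorphD scalerDl opprD addrACA.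
by apply: le_trans (rnormD _ _) _; rewrite lerD.
Qed.

Lemma accretive0 : accretive 0.
Proof. by exists 0; rewrite scale0r subr0 rnorm0. Qed.

Lemma accretive_sum (I : finType) (F : I -> A) :
  (forall i, accretive (F i)) -> accretive (\sum_i F i).
Proof. by move=> h; elim/big_ind: _ => //; [exact: accretive0|exact: accretiveD]. Qed.

Lemma accretiveZ (c : R) a : 0 <= c -> accretive a -> accretive (c%:C *: a).
Proof.
move=> c0 [t ta]; exists (c * t).
by rewrite rmorphM -scalerA -scalerBr rnormZ ger0_norm // ler_wpM2l.
Qed.

Lemma rnorm_alg (t : R) : rnorm (t%:C%:A : A) = `|t|.
Proof. by rewrite rnormZ rnorm1 mulr1. Qed.

Lemma accretiveB (t : R) a : rnorm a <= t -> accretive (t%:C%:A - a).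
Proof. by move=> ta; exists t; rewrite opprB addrC addrNK. Qed.

(** For a witness [u], the scalar [u + t] is the sum of [u - (a - t)], of norm at most [u], and [a];
    the triangle inequality concludes. *)
Lemma accretive_le_rnorm (t : R) a : accretive (a - t%:C%:A) -> t <= rnorm a.
Proof.
move=> [u ua]; have := rnormD (u%:C%:A - (a - t%:C%:A)) a.
have -> : u%:C%:A - (a - t%:C%:A) + a = (u + t)%:C%:A.
  by rewrite opprB addrA addrNK -scalerDl -rmorphD.
by rewrite rnorm_alg; have := ler_norm (u + t); lra.
Qed.

Lemma cpositive_cinvertible (t : R) a : 0 < t -> cpositive a ->
  cinvertible (t%:C%:A + a).
Proof.
move=> t0 [_ sp]; apply: contrapT => nt.
have : cspectrum a (- t%:C).
  by rewrite /cspectrum /= scaleNr opprK addrC.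
by move=> /sp; rewrite oppr_ge0 -(rmorph0 (real_complex R)) lecR leNgt t0.
Qed.

(** The witness is [t = rnorm a]. If [b = t - a] had norm above [t], then
    [rnorm b - b = (rnorm b - t) + a] would be invertible by positivity and
    [rnorm b + b = (rnorm b + t) - a] by the Neumann series, against the spectral radius of [b]. *)
Lemma cpositive_accretive a : cpositive a -> accretive a.
Proof.
move=> pa; have sa := pa.1; exists (rnorm a); set t := rnorm a.
rewrite leNgt; apply/negP => tb; set b := t%:C%:A - a in tb.
have t0 : 0 <= t := rnorm_ge0 a.
have sb : cstar b = b by rewrite raddfB /= cstarZr cstar1 sa.
apply: (not_cinvertible_rnorm sb).
  by apply: contraTneq tb => ->; rewrite rnorm0 -leNgt.
split.
  have -> : (rnorm b)%:C%:A - b = (rnorm b - t)%:C%:A + a.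
    by rewrite opprB addrA addrAC rmorphB scalerBl.
  by apply: cpositive_cinvertible; rewrite ?subr_gt0.
rewrite addrA -scalerDl -rmorphD.
by apply: cinvertibleB; rewrite -/t; lra.
Qed.

(** This is antisymmetry of the order. If [a] were nonzero, [rnorm a + a] would be invertible by
    positivity, and [rnorm a - a = (t + rnorm a) - (t + a)] because [t + a] has norm at most [t],
    against the spectral radius. *)
Lemma cpositive_accretiveN_eq0 a : cpositive a -> accretive (- a) -> a = 0.
Proof.
move=> pa [t]; rewrite opprK => ta; apply/eqP/negP => /negP a0.
have na : 0 < rnorm a.
  by rewrite lt0r rnorm_ge0 andbT; apply: contra_neq a0 => /rnorm0_eq0.
apply: (not_cinvertible_rnorm pa.1 a0); split; last exact: cpositive_cinvertible.
have -> : (rnorm a)%:C%:A - a = (t + rnorm a)%:C%:A - (t%:C%:A + a).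
  by rewrite rmorphD scalerDl opprD addrACA subrr add0r.
by apply: cinvertibleB; lra.
Qed.

End CStar.

(** * Inner product calculus in a Hilbert module *)

Section HilbertModule.
Context {R : realType} {A : cstarAlgType R} {X : hilbertModType A}.
Implicit Types x y z : X.

Lemma hinnerDr x y z : hinner x (y + z) = hinner x y + hinner x z.
Proof. by rewrite -{1}(scale1r y) hinner_linr scale1r. Qed.

Lemma hinner0r x : hinner x 0 = 0.
Proof. by apply: (addrI (hinner x 0)); rewrite -hinnerDr !addr0. Qed.

Lemma hinnerZr (l : R[i]) x y : hinner x (l *: y) = l *: hinner x y.
Proof. by rewrite -[l *: y]addr0 hinner_linr hinner0r addr0. Qed.

Lemma hinnerDl x y z : hinner (x + y) z = hinner x z + hinner y z.
Proof. by rewrite -hinnerC hinnerDr cstarD !hinnerC. Qed.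

Lemma hinner0l x : hinner 0 x = 0.
Proof. by apply: (addrI (hinner 0 x)); rewrite -hinnerDl !addr0. Qed.

Lemma hinnerZl (l : R[i]) x y : hinner (l *: x) y = l^*%C *: hinner x y.
Proof. by rewrite -hinnerC hinnerZr cstarZ hinnerC. Qed.

Lemma hinner_sumr (I : finType) x (F : I -> X) :
  hinner x (\sum_i F i) = \sum_i hinner x (F i).
Proof. by apply: (big_morph (hinner x)); [exact: hinnerDr|exact: hinner0r]. Qed.

Lemma hinner_suml (I : finType) x (F : I -> X) :
  hinner (\sum_i F i) x = \sum_i hinner (F i) x.
Proof.
by apply: (big_morph (hinner^~ x)); [move=> y z; exact: hinnerDl|exact: hinner0l].
Qed.

Lemma rnorm_hinner x : rnorm (hinner x x) = rnorm x ^+ 2.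
Proof.
apply: (@complexI R); rewrite rmorphXn /= -!rnormE hnormE sqrtCK //.
Qed.

Lemma hinner_cpositive x : cpositive (hinner x x).
Proof. by have := hinner_ge0 x; rewrite /cle subr0. Qed.

Lemma hinner_subZ (t : R) x y :
  hinner (x - t%:C *: y) (x - t%:C *: y) =
  hinner x x - t%:C *: (hinner y x + hinner x y) + (t ^+ 2)%:C *: hinner y y.
Proof.
rewrite -scaleNr -rmorphN hinnerDl !hinnerDr !hinnerZl !hinnerZr conjc_real.
rewrite scalerA -rmorphM mulrNN -expr2 !rmorphN !scaleNr scalerDr opprD.
by rewrite [- _ - _]addrC !addrA.
Qed.

(** Conjugate linearity in the first variable turns [i rho] into [- i rho], and the real part of
    [- i h] is the imaginary part of [h]. Hence the coefficient [r + i rho] joins the two families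
    of hypotheses. *)
Lemma hinner_creal_cimag (r rho : R) x y :
  hinner ((r +i* rho) *: x) y + hinner y ((r +i* rho) *: x) =
  2%:C *: (creal (hinner (r%:C *: x) y) + cimag (hinner (rho%:C *: x) y)).
Proof.
rewrite /creal /cimag !hinnerZl hinnerZr !conjc_real -(hinnerC x y) !cstarZr.
set h := hinner x y.
have half (z : R[i]) : 2%:C * (2^-1 * z) = z.
  by rewrite rmorph_nat mulrA mulfV ?mul1r // pnatr_eq0.
rewrite invfM (invCi R[i]) !scalerDr scalerN !scalerA !scalerN !scalerA.
rewrite -!mulrA !half.
rewrite addrACA -scaleNr -!scalerDl; congr (_ *: _ + _ *: _).
  by apply/eqP; rewrite eq_complex /=; simpc.
by apply/eqP; rewrite eq_complex /=; simpc.
Qed.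


End HilbertModule.


(** * The reverse triangle inequality and its equality case *)

Theorem theorem2p5 (R : realType) (A : cstarAlgType R) (X : hilbertModType A)
    (m n : nat) (e : 'I_m -> X) (x : 'I_n -> X) (r rho : 'I_m -> R)
    (e_orth : forall i j : 'I_m, i != j -> hinner (e i) (e j) = 0)
    (e_norm : forall i : 'I_m, `|e i| = 1)
    (Hr : forall (j : 'I_n) (k : 'I_m),
      (0 : A) <=A ((r k ^+ 2)%:C * `|x j|)%:A
        <=A creal (hinner ((r k)%:C *: e k) (x j)))
    (Hrho : forall (j : 'I_n) (k : 'I_m),
      (0 : A) <=A ((rho k ^+ 2)%:C * `|x j|)%:A
        <=A cimag (hinner ((rho k)%:C *: e k) (x j))) :
  (Num.sqrt (\sum_(k < m) (r k ^+ 2 + rho k ^+ 2)))%:C * \sum_(j < n) `|x j|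
    <= `|\sum_(j < n) x j| /\
  ((Num.sqrt (\sum_(k < m) (r k ^+ 2 + rho k ^+ 2)))%:C * \sum_(j < n) `|x j|
     = `|\sum_(j < n) x j|
   <->
   \sum_(j < n) x j =
     (\sum_(j < n) `|x j|) *: \sum_(k < m) (r k +i* rho k) *: e k).
Proof.
set S := \sum_j x j; set y := \sum_k _ *: e k.
pose c k := r k ^+ 2 + rho k ^+ 2; set C := \sum_k _.
pose T : R := \sum_j rnorm (x j).
have c0 k : 0 <= c k by rewrite addr_ge0 ?sqr_ge0.
have C0 : 0 <= C by apply: sumr_ge0 => k _; exact: c0.
have T0 : 0 <= T by apply: sumr_ge0 => j _; exact: rnorm_ge0.
have TE : \sum_j `|x j| = T%:C.
  by rewrite rmorph_sum; apply: eq_bigr => j _; exact: rnormE.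
have e1 k : rnorm (hinner (e k) (e k)) = 1.
  by rewrite rnorm_hinner /rnorm e_norm expr1n.
have yy : hinner y y = \sum_k (c k)%:C *: hinner (e k) (e k).
  rewrite hinner_suml; apply: eq_bigr => k _.
  rewrite hinner_sumr (bigD1 k) //= big1 => [|l lk]; last first.
    by rewrite hinnerZl hinnerZr e_orth 1?eq_sym // !scaler0.
  rewrite addr0 hinnerZl hinnerZr scalerA; congr (_ *: _).
  by apply/eqP; rewrite eq_complex /= /c; apply/andP; split; apply/eqP; ring.
have pairA k j : accretive (hinner ((r k +i* rho k) *: e k) (x j) +
    hinner (x j) ((r k +i* rho k) *: e k) - (2 * (c k * rnorm (x j)))%:C%:A).
  rewrite hinner_creal_cimag rmorphM -scalerA -scalerBr.
  apply: accretiveZ => //.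
  rewrite /c mulrDl rmorphD /= scalerDl opprD addrACA.
  rewrite [(r k ^+ 2 * _)%:C]rmorphM [(rho k ^+ 2 * _)%:C]rmorphM /= -!rnormE.
  apply: accretiveD.
    exact: cpositive_accretive (Hr j k).2.
  exact: cpositive_accretive (Hrho j k).2.
have crossA : accretive (hinner y S + hinner S y - (2 * (C * T))%:C%:A).
  have -> : hinner y S + hinner S y - (2 * (C * T))%:C%:A =
      \sum_k \sum_j (hinner ((r k +i* rho k) *: e k) (x j) +
        hinner (x j) ((r k +i* rho k) *: e k) - (2 * (c k * rnorm (x j)))%:C%:A).
    rewrite hinner_suml [hinner S y]hinner_sumr -big_split /=.
    rewrite mulr_suml mulr_sumr rmorph_sum scaler_suml -sumrB.
    apply: eq_bigr => k _.
    rewrite hinner_sumr hinner_suml -big_split /=.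
    by rewrite !mulr_sumr rmorph_sum scaler_suml -sumrB.
  by apply: accretive_sum => k; apply: accretive_sum.
(* [hinner (e k) (e k)] has norm 1 but may differ from the unit; norm 1 still makes
   [1 - hinner (e k) (e k)] accretive. *)
have yyA : accretive (C%:C%:A - hinner y y).
  have -> : C%:C%:A - hinner y y =
      \sum_k (c k)%:C *: (1%:C%:A - hinner (e k) (e k)).
    rewrite yy rmorph_sum scaler_suml -sumrB.
    by apply: eq_bigr => k _; rewrite scalerBr scale1r.
  by apply: accretive_sum => k; apply/accretiveZ/accretiveB => //; rewrite e1.
set W := hinner (S - T%:C *: y) (S - T%:C *: y).
(* Completing the square: [Z] is [T] times the element of [crossA] plus [T ^+ 2] times that of
   [yyA]. The inner products involving [y] cancel against those in [W], and the scalars leave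
   [- 2 C T^2 + C T^2]. *)
have [Z ZA SE] : exists2 Z, accretive Z &
    hinner S S - (C * T ^+ 2)%:C%:A = W + Z.
  eexists; first exact: accretiveD (accretiveZ T0 crossA)
    (accretiveZ (sqr_ge0 T) yyA).
  rewrite /W hinner_subZ !scalerBr.
  set k : A := _%:A; set a := T%:C *: _; set b := (T ^+ 2)%:C *: hinner y y.
  have -> : T%:C *: (2 * (C * T))%:C%:A = k *+ 2.
    rewrite scalerA -rmorphM /= /k scalerMnl -rmorphMn /=.
    by congr (_%:C *: _); ring.
  have -> : (T ^+ 2)%:C *: C%:C%:A = k by rewrite scalerA -rmorphM /= mulrC.
  rewrite addrACA [_ - a + _]addrA addrNK [b + _]addrC addrNK.
  by rewrite mulr2n opprD addrA addrNK.
have leS : Num.sqrt C * T <= rnorm S.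
  rewrite -(@ler_pXn2r _ 2) ?nnegrE ?rnorm_ge0 ?mulr_ge0 ?sqrtr_ge0 //.
  rewrite exprMn sqr_sqrtr // -rnorm_hinner; apply: accretive_le_rnorm.
  by rewrite SE; apply: accretiveD ZA; exact/cpositive_accretive/hinner_cpositive.
rewrite TE rnormE -rmorphM lecR; split=> //; split.
  (* Equality gives [hinner S S] the norm [C * T ^+ 2], so [C T^2 - hinner S S] is accretive. Adding
     [Z] makes [- W] accretive, and the positive [W] vanishes. *)
  move=> /complexI eqS; apply/eqP; rewrite -subr_eq0; apply/eqP/hinner_eq0.
  apply: cpositive_accretiveN_eq0; first exact: hinner_cpositive.
  have -> : - hinner (S - T%:C *: y) (S - T%:C *: y) =
      (C * T ^+ 2)%:C%:A - hinner S S + Z.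
    by rewrite -[_ - hinner S S]opprB SE opprD addrNK.
  apply: accretiveD ZA; apply: accretiveB.
  by rewrite rnorm_hinner -eqS exprMn sqr_sqrtr.
(* Only the upper bound for [rnorm S] remains; it follows from [rnorm y ^+ 2 <= C], by the triangle
   inequality in [yy]. *)
move=> Sy; congr (_%:C); apply/le_anti; rewrite leS /=.
rewrite Sy rnormZ ger0_norm // mulrC ler_wpM2r //.
rewrite -(@ler_pXn2r _ 2) ?nnegrE ?rnorm_ge0 ?sqrtr_ge0 // sqr_sqrtr //.
rewrite -rnorm_hinner yy; apply: le_trans (rnorm_sum _) _.
by apply: ler_sum => k _; rewrite rnormZ e1 mulr1 ger0_norm.
Qed.
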